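(* Let $R_1,\dots,R_m$ ($m\geq 1$) be a finite family of commutative coherent rings with identity, each of finite Gorenstein weak dimension. Then $\mathcal{SGF}\left(\prod_{i=1}^m R_i\right)=\mathcal{GF}\left(\prod_{i=1}^m R_i\right)$ if and only if $\mathcal{SGF}(R_i)=\mathcal{GF}(R_i)$ for each $i=1,\dots,m$.
   Context: All rings are commutative with identity and all modules are unital. For a ring $R$, $\mathcal{GF}(R)$ denotes the class of all Gorenstein flat $R$-modules and $\mathcal{SGF}(R)$ the class of all strongly Gorenstein flat $R$-modules. An $R$-module $M$ is Gorenstein flat if there is an exact complex of flat $R$-modules $\mathbf{F}=\cdots\to F_1\to F_0\to F_{-1}\to\cdots$ with $M\cong \mathrm{Im}(F_0\to F_{-1})$ such that $\mathbf{F}\otimes_R I$ is exact for every injective $R$-module $I$. An $R$-module $M$ is strongly Gorenstein flat if there is an exact sequence $\mathbf{F}=\cdots\to F\xrightarrow{f}F\xrightarrow{f}F\xrightarrow{f}F\to\cdots$ in which all modules are the same flat $R$-module $F$ and all maps are the same map $f$, such that $M\cong\mathrm{Im}(f)$ and $\mathbf{F}\otimes_R I$ is exact for every injective $R$-module $I$. The Gorenstein flat dimension $\mathrm{Gfd}_R(M)$ is the least integer $n\geq 0$ for which there is an exact sequence $0\to G_n\to\cdots\to G_0\to M\to 0$ with all $G_i$ Gorenstein flat ($\infty$ if no such $n$ exists). The Gorenstein weak dimension of $R$ is $\mathrm{G.wdim}(R)=\sup\{\mathrm{Gfd}_R(M)\mid M \text{ an } R\text{-module}\}$. *)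

(* Defs.v *)
From HB Require Import structures.
From mathcomp Require Import all_boot all_algebra.
From mathcomp Require Import boolp.

Set Implicit Arguments.
Unset Strict Implicit.
Unset Printing Implicit Defensive.

Import GRing.Theory.
Local Open Scope ring_scope.
Local Open Scope quotient_scope.

(* Rings are commutative with identity and may be zero ([comPzRingType]);     *)
(* modules are arbitrary, possibly infinitely generated, [lmodType]s.         *)

(** * Product of a finite family of rings *)

Definition prod_ring (m : nat) (R : 'I_m -> comPzRingType) : Type :=
  {dffun forall i : 'I_m, R i}.

Section ProdRing.
Variables (m : nat) (R : 'I_m -> comPzRingType).
Implicit Types x y z : prod_ring R.

HB.instance Definition _ := Choice.on (prod_ring R).

Definition prod_zero : prod_ring R := [ffun i => 0 : R i].
Definition prod_one : prod_ring R := [ffun i => 1 : R i].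
Definition prod_opp x : prod_ring R := [ffun i => - x i].
Definition prod_add x y : prod_ring R := [ffun i => x i + y i].
Definition prod_mul x y : prod_ring R := [ffun i => x i * y i].

Fact prod_addA : associative prod_add.
Proof. by move=> x y z; apply/ffunP=> i; rewrite !ffunE addrA. Qed.
Fact prod_addC : commutative prod_add.
Proof. by move=> x y; apply/ffunP=> i; rewrite !ffunE addrC. Qed.
Fact prod_add0 : left_id prod_zero prod_add.
Proof. by move=> x; apply/ffunP=> i; rewrite !ffunE add0r. Qed.
Fact prod_addN : left_inverse prod_zero prod_opp prod_add.
Proof. by move=> x; apply/ffunP=> i; rewrite !ffunE addNr. Qed.

HB.instance Definition _ := GRing.isZmodule.Build (prod_ring R)
  prod_addA prod_addC prod_add0 prod_addN.

Fact prod_mulA : associative prod_mul.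
Proof. by move=> x y z; apply/ffunP=> i; rewrite !ffunE mulrA. Qed.
Fact prod_mulC : commutative prod_mul.
Proof. by move=> x y; apply/ffunP=> i; rewrite !ffunE mulrC. Qed.
Fact prod_mul1 : left_id prod_one prod_mul.
Proof. by move=> x; apply/ffunP=> i; rewrite !ffunE mul1r. Qed.
Fact prod_mulDl : left_distributive prod_mul +%R.
Proof. by move=> x y z; apply/ffunP=> i; rewrite !ffunE mulrDl. Qed.

HB.instance Definition _ := GRing.Zmodule_isComPzRing.Build (prod_ring R)
  prod_mulA prod_mulC prod_mul1 prod_mulDl.

End ProdRing.

(** * Submodules, images, isomorphism, exactness *)

Section Submodule.
Variables (R : comPzRingType) (M : lmodType R) (S : submodClosed M).

Definition submodule : Type := {x : M | x \in S}.

HB.instance Definition _ := SubChoice.on submodule.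
HB.instance Definition _ := [SubChoice_isSubLmodule of submodule by <:].

End Submodule.

Section Image.
Variables (R : comPzRingType) (M N : lmodType R) (f : {linear M -> N}).

Definition im_pred : {pred N} := fun y => `[< exists x, f x = y >].

Fact im_pred_closed : submod_closed im_pred.
Proof.
split=> [|a u v /asboolP[x <-] /asboolP[y <-]]; apply/asboolP.
  by exists 0; rewrite linear0.
by exists (a *: x + y); rewrite linearP.
Qed.

HB.instance Definition _ := GRing.isSubmodClosed.Build R N im_pred im_pred_closed.

Definition im_module : lmodType R := submodule im_pred.

End Image.

Definition isomorphic (R : comPzRingType) (M N : lmodType R) : Prop :=
  exists f : {linear M -> N}, bijective f.

Definition surjective (A B : Type) (f : A -> B) : Prop :=
  forall y, exists x, f x = y.

Definition exact (R : comPzRingType) (A B C : lmodType R)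
    (f : {linear A -> B}) (g : {linear B -> C}) : Prop :=
  forall y : B, g y = 0 <-> exists x : A, f x = y.

(** * Tensor product *)

(* [M (x) N] is the set of finite formal sums of pure tensors modulo the      *)
(* congruence generated by the bilinearity relations. Negatives need not be   *)
(* adjoined, as [- (x (x) y) = (- x) (x) y]. The universal property is proved *)
(* below ([tensor_liftE], [tensor_lift_uniq]).                                *)

Section Tensor.
Variables (R : comPzRingType) (M N : lmodType R).

Inductive tensor_eq : seq (M * N) -> seq (M * N) -> Prop :=
| TensorRefl s : tensor_eq s s
| TensorSym s t : tensor_eq s t -> tensor_eq t s
| TensorTrans s t u : tensor_eq s t -> tensor_eq t u -> tensor_eq s u
| TensorCat s s' t t' :
    tensor_eq s s' -> tensor_eq t t' -> tensor_eq (s ++ t) (s' ++ t')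
| TensorCatC s t : tensor_eq (s ++ t) (t ++ s)
| Tensor0 y : tensor_eq [:: (0, y)] [::]
| TensorDl x x' y : tensor_eq [:: (x + x', y)] [:: (x, y); (x', y)]
| TensorDr x y y' : tensor_eq [:: (x, y + y')] [:: (x, y); (x, y')]
| TensorZ a x y : tensor_eq [:: (a *: x, y)] [:: (x, a *: y)].

Definition tensor_rel : rel (seq (M * N)) := fun s t => `[< tensor_eq s t >].

Fact tensor_rel_refl : reflexive tensor_rel.
Proof. by move=> s; apply/asboolP/TensorRefl. Qed.
Fact tensor_rel_sym : symmetric tensor_rel.
Proof.
by move=> s t; apply/idP/idP => /asboolP h; apply/asboolP/TensorSym.
Qed.
Fact tensor_rel_trans : transitive tensor_rel.
Proof.
by move=> t s u /asboolP h /asboolP k; apply/asboolP/(TensorTrans h k).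
Qed.

Canonical tensor_equiv :=
  EquivRel tensor_rel tensor_rel_refl tensor_rel_sym tensor_rel_trans.

Definition tensor : Type := {eq_quot tensor_equiv}.

HB.instance Definition _ := Choice.on tensor.

Definition tensor_pi (s : seq (M * N)) : tensor := \pi_{eq_quot tensor_equiv} s.
Definition tensor_repr (t : tensor) : seq (M * N) :=
  repr (t : {eq_quot tensor_equiv}).

Lemma tensor_reprK t : tensor_pi (tensor_repr t) = t.
Proof. exact: reprK. Qed.

Lemma tensor_piP s t : tensor_pi s = tensor_pi t <-> tensor_eq s t.
Proof.
by split=> [/eqquotP /asboolP // | h]; apply/eqquotP/asboolP.
Qed.

Lemma tensor_repr_pi s : tensor_eq (tensor_repr (tensor_pi s)) s.
Proof. by apply/tensor_piP; rewrite tensor_reprK. Qed.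

Definition tmul (x : M) (y : N) : tensor := tensor_pi [:: (x, y)].

Definition tensor_zero : tensor := tensor_pi [::].
Definition tensor_add (s t : tensor) : tensor :=
  tensor_pi (tensor_repr s ++ tensor_repr t).
Definition tensor_scale (a : R) (t : tensor) : tensor :=
  tensor_pi [seq (a *: p.1, p.2) | p <- tensor_repr t].
Definition tensor_opp (t : tensor) : tensor := tensor_scale (-1) t.

Lemma tensor_add_pi s t :
  tensor_add (tensor_pi s) (tensor_pi t) = tensor_pi (s ++ t).
Proof. by apply/tensor_piP/TensorCat; exact: tensor_repr_pi. Qed.

Lemma tensor_eq_scale a s t : tensor_eq s t ->
  tensor_eq [seq (a *: p.1, p.2) | p <- s] [seq (a *: p.1, p.2) | p <- t].
Proof.
elim=> {s t} [s|s t _|s t u _ hst _|s s' t t' _ hs _ ht|s t|y|x x' y|x y y'|b x y].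
- exact: TensorRefl.
- exact: TensorSym.
- exact: TensorTrans.
- by rewrite !map_cat; exact: TensorCat.
- by rewrite !map_cat; exact: TensorCatC.
- by rewrite /= scaler0; exact: Tensor0.
- by rewrite /= scalerDr; exact: TensorDl.
- exact: TensorDr.
- by rewrite /= scalerA mulrC -scalerA; exact: TensorZ.
Qed.

Lemma tensor_scale_pi a s :
  tensor_scale a (tensor_pi s) = tensor_pi [seq (a *: p.1, p.2) | p <- s].
Proof. by apply/tensor_piP/tensor_eq_scale; exact: tensor_repr_pi. Qed.

Fact tensor_addA : associative tensor_add.
Proof.
move=> x y z; rewrite -[x]tensor_reprK -[y]tensor_reprK -[z]tensor_reprK.
by rewrite !tensor_add_pi catA.
Qed.
Fact tensor_addC : commutative tensor_add.
Proof. by move=> x y; apply/tensor_piP/TensorCatC. Qed.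
Fact tensor_add0 : left_id tensor_zero tensor_add.
Proof. by move=> x; rewrite -[x]tensor_reprK tensor_add_pi. Qed.

Fact tensor_scaleDl t : {morph tensor_scale^~ t : a b / a + b >-> tensor_add a b}.
Proof.
move=> a b /=; rewrite -[t]tensor_reprK !tensor_scale_pi tensor_add_pi.
apply/tensor_piP; elim: (tensor_repr t) => [|[x y] s ihs] /=.
  exact: TensorRefl.
rewrite -cat1s; apply: TensorTrans (TensorCat (TensorRefl _) ihs) _.
rewrite scalerDl.
apply: TensorTrans (TensorCat (TensorDl _ _ _) (TensorRefl _)) _.
rewrite -[(b *: x, y) :: _ in X in tensor_eq _ X]cat1s.
rewrite -[(a *: x, y) :: _ in X in tensor_eq _ X]cat1s.
rewrite -[[:: (a *: x, y); _]]cat1s -!catA; apply: TensorCat; first exact: TensorRefl.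
rewrite !catA; apply: TensorCat; last exact: TensorRefl.
exact: TensorCatC.
Qed.

Fact tensor_scale0 t : tensor_scale 0 t = tensor_zero.
Proof.
rewrite -[t]tensor_reprK tensor_scale_pi; apply/tensor_piP.
elim: (tensor_repr t) => [|[x y] s ihs] /=; first exact: TensorRefl.
by rewrite scale0r -[[::]]cat0s -cat1s; apply: TensorCat ihs; exact: Tensor0.
Qed.

Fact tensor_scale1 : left_id 1 tensor_scale.
Proof.
move=> t; rewrite -[t]tensor_reprK tensor_scale_pi; congr tensor_pi.
by rewrite -[RHS]map_id; apply: eq_map => -[x y] /=; rewrite scale1r.
Qed.

Fact tensor_addN : left_inverse tensor_zero tensor_opp tensor_add.
Proof.
move=> t; rewrite /tensor_opp -[X in tensor_add _ X]tensor_scale1.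
by rewrite -tensor_scaleDl addNr tensor_scale0.
Qed.

HB.instance Definition _ := GRing.isZmodule.Build tensor
  tensor_addA tensor_addC tensor_add0 tensor_addN.

Fact tensor_scaleA a b t : tensor_scale a (tensor_scale b t) = tensor_scale (a * b) t.
Proof.
rewrite -[t]tensor_reprK !tensor_scale_pi -map_comp; congr tensor_pi.
by apply: eq_map => -[x y] /=; rewrite scalerA.
Qed.
Fact tensor_scaleDr : right_distributive tensor_scale +%R.
Proof.
move=> a s t; rewrite -[s]tensor_reprK -[t]tensor_reprK.
by rewrite /GRing.add /= !(tensor_add_pi, tensor_scale_pi) map_cat.
Qed.

HB.instance Definition _ := GRing.Zmodule_isLmodule.Build R tensor
  tensor_scaleA tensor_scale1 tensor_scaleDr tensor_scaleDl.

Lemma tensor_piD s t : tensor_pi (s ++ t) = tensor_pi s + tensor_pi t.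
Proof. by rewrite -tensor_add_pi. Qed.

Lemma tensor_piZ a s :
  tensor_pi [seq (a *: p.1, p.2) | p <- s] = a *: tensor_pi s.
Proof. by rewrite -tensor_scale_pi. Qed.

Lemma tensor_pi_sum s : tensor_pi s = \sum_(p <- s) tmul p.1 p.2.
Proof.
elim: s => [|[x y] s ihs]; first by rewrite big_nil.
by rewrite big_cons -ihs -cat1s tensor_piD.
Qed.

Lemma tensor_sum t : t = \sum_(p <- tensor_repr t) tmul p.1 p.2.
Proof. by rewrite -tensor_pi_sum tensor_reprK. Qed.

Lemma tmul_linearl y : linear (tmul^~ y).
Proof.
move=> a x x'; rewrite -tensor_piZ -tensor_piD.
by apply/tensor_piP; exact: TensorDl.
Qed.

Lemma tmul_linearr x : linear (tmul x).
Proof.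
move=> a y y'; rewrite -tensor_piZ -tensor_piD.
apply/tensor_piP; apply: TensorTrans (TensorDr _ _ _) _.
rewrite -cat1s -[X in tensor_eq _ X]cat1s; apply: TensorCat; last exact: TensorRefl.
by apply: TensorSym; exact: TensorZ.
Qed.

Section Lift.
Variables (P : lmodType R) (h : M -> N -> P).

Definition tensor_lift (t : tensor) : P := \sum_(p <- tensor_repr t) h p.1 p.2.

Hypothesis h_linearl : forall y, linear (h^~ y).
Hypothesis h_linearr : forall x, linear (h x).

Lemma tensor_lift_pi s : tensor_lift (tensor_pi s) = \sum_(p <- s) h p.1 p.2.
Proof.
have hDl x x' y : h (x + x') y = h x y + h x' y.
  by have := h_linearl y 1 x x'; rewrite !scale1r.
have hDr x y y' : h x (y + y') = h x y + h x y'.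
  by have := h_linearr x 1 y y'; rewrite !scale1r.
have h0l y : h 0 y = 0 by apply: (addrI (h 0 y)); rewrite -hDl !addr0.
have h0r x : h x 0 = 0 by apply: (addrI (h x 0)); rewrite -hDr !addr0.
have hZl a x y : h (a *: x) y = a *: h x y.
  by have := h_linearl y a x 0; rewrite h0l !addr0.
have hZr a x y : h x (a *: y) = a *: h x y.
  by have := h_linearr x a y 0; rewrite h0r !addr0.
rewrite /tensor_lift; move: (tensor_repr _) (tensor_repr_pi s) => s0 h0.
elim: {s s0} h0 => [//|s t _ -> //|s t u _ -> _ -> //|s s' t t' _ hs _ ht|s t|y|x x' y|x y y'|a x y].
- by rewrite !big_cat hs ht.
- by rewrite !big_cat /= addrC.
- by rewrite big_seq1 big_nil h0l.
- by rewrite big_seq1 2!big_cons big_nil addr0 hDl.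
- by rewrite big_seq1 2!big_cons big_nil addr0 hDr.
- by rewrite !big_seq1 hZl hZr.
Qed.

Lemma tensor_liftE x y : tensor_lift (tmul x y) = h x y.
Proof. by rewrite tensor_lift_pi big_seq1. Qed.

Lemma tensor_lift_linear : linear tensor_lift.
Proof.
move=> a s t; rewrite -[s]tensor_reprK -[t]tensor_reprK.
rewrite -tensor_piZ -tensor_piD !tensor_lift_pi.
rewrite big_cat big_map scaler_sumr; congr (_ + _); apply: eq_bigr => -[x y] _ /=.
have h0 : h 0 y = 0.
  by apply: (addrI (h 0 y)); have := h_linearl y 1 0 0; rewrite !scale1r !addr0.
by have := h_linearl y a x 0; rewrite h0 !addr0.
Qed.

End Lift.

Lemma tensor_lift_uniq (P : lmodType R) (f g : {linear tensor -> P}) :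
  (forall x y, f (tmul x y) = g (tmul x y)) -> f =1 g.
Proof.
by move=> fg t; rewrite (tensor_sum t) !linear_sum; apply: eq_bigr => p _; exact: fg.
Qed.

End Tensor.

Section TensorMap.
Variables (R : comPzRingType) (M M' N N' : lmodType R).
Variables (f : {linear M -> M'}) (g : {linear N -> N'}).

Definition tensor_map : tensor M N -> tensor M' N' :=
  tensor_lift (fun x y => tmul (f x) (g y)).

Fact tensor_map_linearl y : linear (fun x => tmul (f x) (g y)).
Proof. by move=> a x x'; rewrite linearP tmul_linearl. Qed.
Fact tensor_map_linearr x : linear (fun y => tmul (f x) (g y)).
Proof. by move=> a y y'; rewrite linearP tmul_linearr. Qed.

Fact tensor_map_linear : linear tensor_map.
Proof. exact: tensor_lift_linear tensor_map_linearl tensor_map_linearr. Qed.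

HB.instance Definition _ :=
  GRing.isLinear.Build R (tensor M N) (tensor M' N') _ tensor_map
    tensor_map_linear.

Lemma tensor_mapE x y : tensor_map (tmul x y) = tmul (f x) (g y).
Proof. exact: tensor_liftE tensor_map_linearl tensor_map_linearr x y. Qed.

End TensorMap.

(** * Flat and injective modules, coherent rings *)

Definition flat (R : comPzRingType) (F : lmodType R) : Prop :=
  forall (A B C : lmodType R) (f : {linear A -> B}) (g : {linear B -> C}),
    exact f g ->
    exact (tensor_map (idfun : {linear F -> F}) f)
          (tensor_map (idfun : {linear F -> F}) g).

Definition injective_module (R : comPzRingType) (I : lmodType R) : Prop :=
  forall (A B : lmodType R) (j : {linear A -> B}) (f : {linear A -> I}),
    injective j -> exists g : {linear B -> I}, forall x, g (j x) = f x.

Definition finitely_generated (R : comPzRingType) (M : lmodType R) : Prop :=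
  exists (n : nat) (p : {linear 'rV[R]_n -> M}), surjective p.

Definition finitely_presented (R : comPzRingType) (M : lmodType R) : Prop :=
  exists (k n : nat) (r : {linear 'rV[R]_k -> 'rV[R]_n})
         (p : {linear 'rV[R]_n -> M}), exact r p /\ surjective p.

(* The ideals of [R] are the submodules of the regular module [R^o].          *)
Definition coherent (R : comPzRingType) : Prop :=
  forall I : submodClosed R^o,
    finitely_generated (submodule I) -> finitely_presented (submodule I).

(** * Gorenstein flat modules *)

(* A sequence [... -> C_{n+1} -> C_n -> C_{n-1} -> ...] of modules and linear *)
(* maps; [exact_seq] includes the condition that it is a complex.             *)
Record mod_seq (R : comPzRingType) := ModSeq {
  obj :> int -> lmodType R;
  diff : forall n : int, {linear obj n -> obj (n - 1)}
}.

Section Gorenstein.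
Variable R : comPzRingType.
Implicit Types (C : mod_seq R) (M N F G I : lmodType R).

Definition exact_seq C : Prop :=
  forall n : int, exact (diff C n) (diff C (n - 1)).

Definition tensor_seq C I : mod_seq R :=
  @ModSeq R (fun n => tensor (C n) I)
    (fun n => tensor_map (diff C n) (idfun : {linear I -> I})).

Definition const_seq F (f : {linear F -> F}) : mod_seq R :=
  @ModSeq R (fun _ => F) (fun _ => f).

Definition Gorenstein_flat M : Prop :=
  exists C : mod_seq R,
    [/\ forall n, flat (C n),
        exact_seq C,
        isomorphic M (im_module (diff C 0))
      & forall I, injective_module I -> exact_seq (tensor_seq C I)].

Definition strongly_Gorenstein_flat M : Prop :=
  exists (F : lmodType R) (f : {linear F -> F}),
    [/\ flat F,
        exact_seq (const_seq f),
        isomorphic M (im_module f)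
      & forall I, injective_module I -> exact_seq (tensor_seq (const_seq f) I)].

(* An exact sequence [0 -> G_n -> ... -> G_0 -> M -> 0] with all [G_i]        *)
(* Gorenstein flat, continued on the left by zero modules.                    *)
Definition has_Gflat_resolution M (n : nat) : Prop :=
  exists (G : nat -> lmodType R) (d : forall i, {linear G i.+1 -> G i})
         (e : {linear G 0 -> M}),
    [/\ forall i, (i <= n)%N -> Gorenstein_flat (G i),
        forall i, (n < i)%N -> forall x : G i, x = 0,
        surjective e,
        exact (d 0) e
      & forall i, exact (d i.+1) (d i)].

(* [None] stands for infinity in [nat] extended by infinity.                  *)
Definition least (P : nat -> Prop) : option nat :=
  if pselect (exists n, `[< P n >]) is left exP then Some (ex_minn exP) else None.

Definition Gfd M : option nat := least (has_Gflat_resolution M).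

Definition ext_le (d : option nat) (n : nat) : Prop :=
  if d is Some k then (k <= n)%N else False.

(* The supremum of a family in [nat] extended by infinity is its least finite *)
(* upper bound, or infinity if there is none.                                 *)
Definition Gwdim : option nat := least (fun n => forall M, ext_le (Gfd M) n).

Definition SGF_eq_GF : Prop :=
  forall M, strongly_Gorenstein_flat M <-> Gorenstein_flat M.

End Gorenstein.

(* Main.v *)
Require Import Defs.
From HB Require Import structures.
From mathcomp Require Import all_boot all_algebra.
From mathcomp Require Import boolp.

Set Implicit Arguments.
Unset Strict Implicit.
Unset Printing Implicit Defensive.

Import GRing.Theory.
Local Open Scope ring_scope.

(** Write S for the product of the rings R_i and e_i for its standard
idempotents. The e_i are orthogonal and sum to 1, so that an S-module M is the
direct sum of its corners e_i M, and e_i M is a module over R_i: the modules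
over S are the families of modules over the R_i. The theorem holds because this
equivalence of categories respects every notion that occurs in the two
definitions of Gorenstein flatness, strong or not.

The equivalence is used through one relation only. A [component] presents an
R_i-module N as the i-th corner of an S-module M: a semilinear projection from M
to N with a section, whose composite in M is multiplication by e_i. Corners
([corner_component]), factors of a product of modules ([coord_component]) and
modules obtained by restriction of scalars along the projection from S to R_i
([res_component]) are all instances, and components are inherited by tensor
products ([tensor_component]) and by images ([im_component]).

A sequence of S-modules is exact if and only if all its components are
([exact_component], [exact_components]). Combined with the tensor product, this
shows that an S-module is flat if and only if all its components are; in the
direct implication, the test sequences of R_i-modules are restricted to S.
Injectivity passes to components, and restriction to S preserves it. Thus
complexes that are exact, flat, and remain exact after tensoring with injective
modules pass to components and are detected by them, and the two classes of
modules correspond: M is (strongly) Gorenstein flat if and only if all its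
components are. A constant sequence with a constant differential stays constant
under passing to corners and to products, which is what makes the argument apply
to the strong notion.

If the classes agree over every R_i they therefore agree over S. Conversely, a
Gorenstein flat R_i-module M is the i-th factor of the S-module whose other
factors are zero; that product is Gorenstein flat, hence strongly so, and M
inherits this as a component. *)

(** * Linear maps and pure tensors *)

Definition lin_of (R : comPzRingType) (A B : lmodType R) (f : A -> B)
    (fP : linear f) : {linear A -> B} :=
  HB.pack f (GRing.isLinear.Build R A B *:%R f fP).

Section TensorScale.
Variables (R : comPzRingType) (M N : lmodType R).

Lemma tmulZl a (x : M) (y : N) : tmul (a *: x) y = a *: tmul x y.
Proof. exact: (linearZ_LR (lin_of (tmul_linearl y)) a x). Qed.

Lemma tmulZr a (x : M) (y : N) : tmul x (a *: y) = a *: tmul x y.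
Proof. exact: (linearZ_LR (lin_of (tmul_linearr x)) a y). Qed.

End TensorScale.

(** * Components of a module over a product of rings *)

Section Components.
Variables (m : nat) (R : 'I_m -> comPzRingType).
Local Notation S := (prod_ring R).

Definition single (i : 'I_m) (r : R i) : S := 
  [ffun j => @dfwith _ (fun j : 'I_m => R j) (fun j => 0 : R j) i r j].

Lemma single_in i (r : R i) : single r i = r.
Proof. by rewrite ffunE dfwith_in. Qed.

Lemma mul_single (a : S) i (r : R i) : a * single r = single (a i * r).
Proof.
apply/ffunP=> j; rewrite !ffunE; have [<-|/eqP ij] := eqVneq i j.
  by rewrite !dfwith_in.
by rewrite !dfwith_out ?mulr0 //; apply/eqP.
Qed.

Lemma singleD i (r s : R i) : single (r + s) = single r + single s.
Proof.
apply/ffunP=> j; rewrite !ffunE; have [<-|ij] := eqVneq i j.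
  by rewrite !dfwith_in.
by rewrite !dfwith_out ?addr0.
Qed.

Lemma sum_single1 : \sum_i single (1 : R i) = 1 :> S.
Proof.
have sumE (F : 'I_m -> S) j : (\sum_i F i) j = \sum_i F i j.
  by elim/big_rec2: _ => [|i x y _ <-]; rewrite ffunE.
apply/ffunP=> j; rewrite sumE (bigD1 j) //= single_in big1 ?addr0 ?ffunE //.
by move=> i ij; rewrite ffunE dfwith_out.
Qed.

(** The last field identifies N with e_i M: elements in the range of [cincl] are
fixed by e_i, from which the semilinearity of [cincl] follows ([cinclP]). *)
Record component (i : 'I_m) (M : lmodType S) (N : lmodType (R i)) := Component {
  cproj : M -> N;
  cincl : N -> M;
  cprojP : forall (a : S) x y, cproj (a *: x + y) = a i *: cproj x + cproj y;
  cinclK : cancel cincl cproj;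
  cprojK : forall x, cincl (cproj x) = single (1 : R i) *: x }.

Section ComponentTheory.
Variables (i : 'I_m) (M : lmodType S) (N : lmodType (R i)) (c : component M N).

Lemma cprojD x y : cproj c (x + y) = cproj c x + cproj c y.
Proof. by rewrite -[x]scale1r cprojP ffunE !scale1r. Qed.

Lemma cproj0 : cproj c 0 = 0.
Proof. by apply: (addrI (cproj c 0)); rewrite -cprojD !addr0. Qed.

Lemma cprojZ a x : cproj c (a *: x) = a i *: cproj c x.
Proof. by rewrite -[_ *: x]addr0 cprojP cproj0 addr0. Qed.

Lemma single_cincl x : single (1 : R i) *: cincl c x = cincl c x.
Proof. by rewrite -(cprojK c) cinclK. Qed.

(** Both sides are fixed by e_i and have the same projection; on elements fixed
by e_i the projection is injective. *)
Lemma cinclP (a : S) x y : cincl c (a i *: x + y) = a *: cincl c x + cincl c y.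
Proof.
rewrite -{1}[x](cinclK c) -{1}[y](cinclK c) -cprojP cprojK scalerDr scalerA mulrC.
by rewrite -scalerA !single_cincl.
Qed.

Lemma cincl_linear (r : R i) x y :
  cincl c (r *: x + y) = single r *: cincl c x + cincl c y.
Proof. by rewrite -cinclP single_in. Qed.

Lemma cinclD x y : cincl c (x + y) = cincl c x + cincl c y.
Proof. by have := cinclP 1 x y; rewrite ffunE !scale1r. Qed.

Lemma cincl0 : cincl c 0 = 0.
Proof. by apply: (addrI (cincl c 0)); rewrite -cinclD !addr0. Qed.

End ComponentTheory.

(** The idempotents e_i sum to 1, so a module is recovered from its components. *)
Lemma sum_cprojK (M : lmodType S) (N : forall i, lmodType (R i))
    (c : forall i, component M (N i)) x :
  \sum_i cincl (c i) (cproj (c i) x) = x.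
Proof.
rewrite -[RHS]scale1r -sum_single1 scaler_suml.
by apply: eq_bigr => i _; rewrite cprojK.
Qed.

Lemma eq_cproj (M : lmodType S) (N : forall i, lmodType (R i))
    (c : forall i, component M (N i)) x y :
  (forall i, cproj (c i) x = cproj (c i) y) -> x = y.
Proof.
move=> xy; rewrite -(sum_cprojK c x) -(sum_cprojK c y).
by apply: eq_bigr => i _; rewrite xy.
Qed.

(** The idempotents are orthogonal, so components can be prescribed
independently of each other. *)
Lemma cproj_sum_cincl (M : lmodType S) (N : forall i, lmodType (R i))
    (c : forall i, component M (N i)) (x : forall i, N i) j :
  cproj (c j) (\sum_i cincl (c i) (x i)) = x j.
Proof.
rewrite (bigD1 j) //= cprojD cinclK -[RHS]addr0; congr (_ + _).
elim/big_ind: _ => [|u v hu hv|k kj]; first exact: cproj0.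
  by rewrite cprojD hu hv addr0.
by rewrite -single_cincl cprojZ ffunE dfwith_out ?scale0r.
Qed.

Definition compatible i (M M' : lmodType S) (N N' : lmodType (R i))
    (c : component M N) (c' : component M' N')
    (f : {linear M -> M'}) (g : {linear N -> N'}) :=
  forall x, cproj c' (f x) = g (cproj c x).

(** Commuting with the projections is enough: the sections are fixed by e_i, with
which linear maps commute. *)
Lemma compatible_cincl i (M M' : lmodType S) (N N' : lmodType (R i))
    (c : component M N) (c' : component M' N')
    (f : {linear M -> M'}) (g : {linear N -> N'}) :
  compatible c c' f g -> forall x, f (cincl c x) = cincl c' (g x).
Proof.
move=> fg x; rewrite -{2}[x](cinclK c) -fg cprojK -linearZ.
by rewrite single_cincl.
Qed.

(** * Exactness is tested on components *)

(** Include the component into the sequence over the product, solve there, and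
project back. *)
Lemma exact_component i (A B C : lmodType S) (A' B' C' : lmodType (R i))
    (cA : component A A') (cB : component B B') (cC : component C C')
    (f : {linear A -> B}) (g : {linear B -> C})
    (f' : {linear A' -> B'}) (g' : {linear B' -> C'}) :
  compatible cA cB f f' -> compatible cB cC g g' ->
  exact f g -> exact f' g'.
Proof.
move=> ff gg fg y; split=> [gy0|[x <-]].
  have /fg[x fx] : g (cincl cB y) = 0.
    by rewrite (compatible_cincl gg) gy0 cincl0.
  by exists (cproj cA x); rewrite -ff fx cinclK.
rewrite -[LHS](cinclK cC) -(compatible_cincl gg) -(compatible_cincl ff).
have -> : g (f (cincl cA x)) = 0 by apply/fg; exists (cincl cA x).
exact: cproj0.
Qed.

(** Preimages found in each component assemble into a single one, since finitely
many components can be prescribed at once. *)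
Lemma exact_components (A B C : lmodType S) (A' B' C' : forall i, lmodType (R i))
    (cA : forall i, component A (A' i)) (cB : forall i, component B (B' i))
    (cC : forall i, component C (C' i))
    (f : {linear A -> B}) (g : {linear B -> C})
    (f' : forall i, {linear A' i -> B' i}) (g' : forall i, {linear B' i -> C' i}) :
  (forall i, compatible (cA i) (cB i) f (f' i)) ->
  (forall i, compatible (cB i) (cC i) g (g' i)) ->
  (forall i, exact (f' i) (g' i)) -> exact f g.
Proof.
move=> ff gg fg y; split=> [gy0|[x <-]]; last first.
  apply: (eq_cproj (c := cC)) => i; rewrite gg ff cproj0.
  by apply/fg; exists (cproj (cA i) x).
have /fin_all_exists[x xP] i : exists x, f' i x = cproj (cB i) y.
  by apply/fg; rewrite -gg gy0 cproj0.
exists (\sum_i cincl (cA i) (x i)).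
by apply: (eq_cproj (c := cB)) => i; rewrite ff cproj_sum_cincl xP.
Qed.

(** * Restriction of scalars, corners and products *)

Section Restriction.
Variables (i : 'I_m).

(** A copy of the carrier, so that N keeps its module structure over R_i while
the copy carries the one over the product ring. *)
Definition res (N : lmodType (R i)) : Type := N.

Section ResModule.
Variable N : lmodType (R i).

HB.instance Definition _ := GRing.Zmodule.on (res N).

Definition res_scale (a : S) (x : res N) : res N := a i *: (x : N).

Fact res_scaleA a b x : res_scale a (res_scale b x) = res_scale (a * b) x.
Proof. by rewrite /res_scale scalerA ffunE. Qed.
Fact res_scale1 : left_id 1 res_scale.
Proof. by move=> x; rewrite /res_scale ffunE scale1r. Qed.
Fact res_scaleDr : right_distributive res_scale +%R.
Proof. by move=> a x y; rewrite /res_scale scalerDr. Qed.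
Fact res_scaleDl x : {morph res_scale^~ x : a b / a + b}.
Proof. by move=> a b; rewrite /res_scale ffunE scalerDl. Qed.

HB.instance Definition _ := GRing.Zmodule_isLmodule.Build S (res N)
  res_scaleA res_scale1 res_scaleDr res_scaleDl.

Lemma single_res (r : R i) (x : res N) : single r *: x = (r *: (x : N) : res N).
Proof. by rewrite -{2}(single_in r). Qed.

Fact res_projP (a : S) (x y : res N) :
  (a *: x + y : res N) = a i *: (x : N) + (y : N).
Proof. by []. Qed.
Fact res_projK (x : res N) : x = single (1 : R i) *: x.
Proof. by rewrite single_res scale1r. Qed.

Definition res_component : component (res N) N :=
  Component (cproj := fun x : res N => x : N) (cincl := fun x : N => x : res N)
    res_projP (fun=> erefl) res_projK.

End ResModule.

Fact res_map_linear (M N : lmodType (R i)) (f : {linear M -> N}) :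
  linear (f : res M -> res N).
Proof. by move=> a x y; exact: (linearP f (a i) x y). Qed.

Definition res_map (M N : lmodType (R i)) (f : {linear M -> N}) :
  {linear res M -> res N} := lin_of (res_map_linear f).

End Restriction.

Section Corner.
Variable i : 'I_m.

Section CornerModule.
Variable M : lmodType S.

Definition corner_pred : {pred M} := fun x => single (1 : R i) *: x == x.

Fact corner_closed : submod_closed corner_pred.
Proof.
split=> [|a u v /eqP hu /eqP hv]; apply/eqP; first by rewrite scaler0.
by rewrite scalerDr scalerA mulrC -scalerA hu hv.
Qed.

HB.instance Definition _ := GRing.isSubmodClosed.Build S M corner_pred corner_closed.

(** A submodule over the product ring on which e_i acts as the identity: this
is what turns the non-unital embedding [single] of R_i into a unital action. *)
Definition corner : Type := submodule corner_pred.

HB.instance Definition _ := GRing.Zmodule.on corner.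

Definition corner_scale (r : R i) (x : corner) : corner :=
  (single r : S) *: (x : submodule corner_pred).

Fact corner_val (x : corner) : single (1 : R i) *: val x = val x.
Proof. exact/eqP/(valP x). Qed.
Fact corner_scaleA a b x :
  corner_scale a (corner_scale b x) = corner_scale (a * b) x.
Proof. by rewrite /corner_scale scalerA mul_single single_in. Qed.
Fact corner_scale1 : left_id 1 corner_scale.
Proof. by move=> x; apply: val_inj; rewrite /= corner_val. Qed.
Fact corner_scaleDr : right_distributive corner_scale +%R.
Proof. by move=> a x y; rewrite /corner_scale scalerDr. Qed.
Fact corner_scaleDl x : {morph corner_scale^~ x : a b / a + b}.
Proof. by move=> a b; rewrite /corner_scale singleD scalerDl. Qed.

HB.instance Definition _ := GRing.Zmodule_isLmodule.Build (R i) corner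
  corner_scaleA corner_scale1 corner_scaleDr corner_scaleDl.

Fact corner_projE x : single (1 : R i) *: x \in corner_pred.
Proof. by apply/eqP; rewrite scalerA mul_single single_in mulr1. Qed.

Definition corner_proj (x : M) : corner := 
  exist (fun y => y \in corner_pred) _ (corner_projE x).

Fact corner_projP (a : S) x y :
  corner_proj (a *: x + y) = a i *: corner_proj x + corner_proj y.
Proof.
apply: val_inj => /=; rewrite scalerDr !scalerA !mul_single single_in mulr1.
by rewrite mulrC mul_single mulr1.
Qed.
Fact corner_inclK : cancel val corner_proj.
Proof. by move=> x; apply: val_inj; rewrite /= corner_val. Qed.

Definition corner_component : component M corner :=
  Component corner_projP corner_inclK (fun=> erefl).

End CornerModule.

Section CornerMap.
Variables (M N : lmodType S) (f : {linear M -> N}).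

Definition corner_map_fun (x : corner M) : corner N :=
  cproj (corner_component N) (f (cincl (corner_component M) x)).

Fact corner_map_linear : linear corner_map_fun.
Proof.
by move=> r x y; rewrite /corner_map_fun cincl_linear linearP cprojP single_in.
Qed.

Definition corner_map : {linear corner M -> corner N} := lin_of corner_map_linear.

Lemma corner_map_compatible :
  compatible (corner_component M) (corner_component N) f corner_map.
Proof.
move=> x; rewrite /= /corner_map_fun cprojK linearZ cprojZ single_in.
by rewrite scale1r.
Qed.

End CornerMap.
End Corner.


Section Product.
Variable N : forall i, lmodType (R i).

Definition prod_module : Type := {dffun forall i : 'I_m, N i}.
Implicit Types x y : prod_module.

HB.instance Definition _ := Choice.on prod_module.

Definition prodm_zero : prod_module := [ffun i => 0 : N i].
Definition prodm_opp x : prod_module := [ffun i => - x i].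
Definition prodm_add x y : prod_module := [ffun i => x i + y i].
Definition prodm_scale (a : S) x : prod_module := [ffun i => a i *: x i].

Fact prodm_addA : associative prodm_add.
Proof. by move=> x y z; apply/ffunP=> i; rewrite !ffunE addrA. Qed.
Fact prodm_addC : commutative prodm_add.
Proof. by move=> x y; apply/ffunP=> i; rewrite !ffunE addrC. Qed.
Fact prodm_add0 : left_id prodm_zero prodm_add.
Proof. by move=> x; apply/ffunP=> i; rewrite !ffunE add0r. Qed.
Fact prodm_addN : left_inverse prodm_zero prodm_opp prodm_add.
Proof. by move=> x; apply/ffunP=> i; rewrite !ffunE addNr. Qed.

HB.instance Definition _ := GRing.isZmodule.Build prod_module
  prodm_addA prodm_addC prodm_add0 prodm_addN.

Fact prodm_scaleA a b x : prodm_scale a (prodm_scale b x) = prodm_scale (a * b) x.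
Proof. by apply/ffunP=> i; rewrite !ffunE scalerA. Qed.
Fact prodm_scale1 : left_id 1 prodm_scale.
Proof. by move=> x; apply/ffunP=> i; rewrite !ffunE scale1r. Qed.
Fact prodm_scaleDr : right_distributive prodm_scale +%R.
Proof. by move=> a x y; apply/ffunP=> i; rewrite !ffunE scalerDr. Qed.
Fact prodm_scaleDl x : {morph prodm_scale^~ x : a b / a + b}.
Proof. by move=> a b; apply/ffunP=> i; rewrite !ffunE scalerDl. Qed.

HB.instance Definition _ := GRing.Zmodule_isLmodule.Build S prod_module
  prodm_scaleA prodm_scale1 prodm_scaleDr prodm_scaleDl.

Section Coordinate.
Variable i : 'I_m.

Definition coord_incl (x : N i) : prod_module :=
  [ffun j => @dfwith _ (fun j : 'I_m => N j) (fun j => 0 : N j) i x j].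

Fact coord_projP (a : S) x y : (a *: x + y) i = a i *: x i + y i.
Proof. by rewrite !ffunE. Qed.
Fact coord_inclK : cancel coord_incl (fun x : prod_module => x i).
Proof. by move=> x; rewrite ffunE dfwith_in. Qed.
Fact coord_projK x : coord_incl (x i) = single (1 : R i) *: x.
Proof.
apply/ffunP=> j; rewrite !ffunE; have [<-|ij] := eqVneq i j.
  by rewrite !dfwith_in scale1r.
by rewrite !dfwith_out ?scale0r.
Qed.

Definition coord_component : component prod_module (N i) :=
  Component coord_projP coord_inclK coord_projK.

End Coordinate.
End Product.

Section ProductMap.
Variables (N P : forall i, lmodType (R i)) (f : forall i, {linear N i -> P i}).

Definition prod_map_fun (x : prod_module N) : prod_module P := [ffun i => f i (x i)].

Fact prod_map_linear : linear prod_map_fun.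
Proof. by move=> a x y; apply/ffunP=> i; rewrite !ffunE linearP. Qed.

Definition prod_map : {linear prod_module N -> prod_module P} :=
  lin_of prod_map_linear.

Lemma prod_map_compatible i :
  compatible (coord_component N i) (coord_component P i) prod_map (f i).
Proof. by move=> x; rewrite /= ffunE. Qed.

End ProductMap.

(** * Tensor products, flatness and injectivity *)

Section TensorComponent.
Variables (i : 'I_m) (A B : lmodType S) (A' B' : lmodType (R i)).
Variables (cA : component A A') (cB : component B B').
Local Notation cAB := (corner_component i (tensor A B)).

(** The target is restricted to the product ring because the universal property
of the tensor product over that ring only produces maps linear over it. *)
Definition tensor_proj : tensor A B -> res (tensor A' B') :=
  tensor_lift (fun x y => tmul (cproj cA x) (cproj cB y) : res _).

Fact tensor_proj_linl y :
  linear (fun x => tmul (cproj cA x) (cproj cB y) : res (tensor A' B')).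
Proof. by move=> a x x'; rewrite cprojP tmul_linearl. Qed.
Fact tensor_proj_linr x :
  linear (fun y => tmul (cproj cA x) (cproj cB y) : res (tensor A' B')).
Proof. by move=> a y y'; rewrite cprojP tmul_linearr. Qed.

Fact tensor_proj_linear : linear tensor_proj.
Proof. exact: tensor_lift_linear tensor_proj_linl tensor_proj_linr. Qed.

Lemma tensor_projE x y :
  tensor_proj (tmul x y) = tmul (cproj cA x) (cproj cB y).
Proof. exact: tensor_liftE tensor_proj_linl tensor_proj_linr x y. Qed.

(** Likewise, the tensor product over R_i only maps to R_i-modules, hence to the
corner of the tensor product over the product ring rather than to the whole. *)
Definition tensor_corner : tensor A' B' -> corner i (tensor A B) :=
  tensor_lift (fun x y => cproj cAB (tmul (cincl cA x) (cincl cB y))).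

Fact tensor_corner_linl y :
  linear (fun x => cproj cAB (tmul (cincl cA x) (cincl cB y))).
Proof. by move=> a x x'; rewrite cincl_linear tmul_linearl cprojP single_in. Qed.
Fact tensor_corner_linr x :
  linear (fun y => cproj cAB (tmul (cincl cA x) (cincl cB y))).
Proof. by move=> a y y'; rewrite cincl_linear tmul_linearr cprojP single_in. Qed.

Fact tensor_corner_linear : linear tensor_corner.
Proof. exact: tensor_lift_linear tensor_corner_linl tensor_corner_linr. Qed.

Lemma tensor_cornerE x y :
  tensor_corner (tmul x y) = cproj cAB (tmul (cincl cA x) (cincl cB y)).
Proof. exact: tensor_liftE tensor_corner_linl tensor_corner_linr x y. Qed.

Definition tensor_incl (t : tensor A' B') : tensor A B :=
  cincl cAB (tensor_corner t).

Fact tensor_inclK : cancel tensor_incl (tensor_proj : _ -> tensor A' B').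
Proof.
have lin : linear (fun t => tensor_proj (tensor_incl t) : tensor A' B').
  move=> r s t; rewrite /tensor_incl tensor_corner_linear cincl_linear.
  by rewrite tensor_proj_linear single_res.
move=> t; apply: (tensor_lift_uniq (f := lin_of lin) (g := idfun)) => x y /=.
rewrite /tensor_incl tensor_cornerE cprojK -tmulZl single_cincl tensor_projE.
by rewrite !cinclK.
Qed.

Fact tensor_projK t : tensor_incl (tensor_proj t) = single (1 : R i) *: t.
Proof.
have linl : linear (fun t => tensor_incl (tensor_proj t)).
  move=> a x y; rewrite tensor_proj_linear /tensor_incl.
  by rewrite [X in cincl _ X]tensor_corner_linear cinclP.
have linr : linear (fun t : tensor A B => single (1 : R i) *: t).
  by move=> a x y; rewrite scalerDr !scalerA mulrC.
apply: (tensor_lift_uniq (f := lin_of linl) (g := lin_of linr)) => x y /=.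
rewrite /tensor_incl tensor_projE tensor_cornerE !cprojK.
by rewrite tmulZl tmulZr !scalerA !mul_single !single_in !mulr1.
Qed.

(** The tensor product over R_i of components is the component of the tensor
product over S, because e_i can be moved across the tensor sign and is
idempotent. *)
Definition tensor_component : component (tensor A B) (tensor A' B') :=
  Component tensor_proj_linear tensor_inclK tensor_projK.

End TensorComponent.

Lemma tensor_compatible i (A A1 B B1 : lmodType S) (A' A1' B' B1' : lmodType (R i))
    (cA : component A A') (cA1 : component A1 A1')
    (cB : component B B') (cB1 : component B1 B1')
    (f : {linear A -> A1}) (f' : {linear A' -> A1'})
    (g : {linear B -> B1}) (g' : {linear B' -> B1'}) :
  compatible cA cA1 f f' -> compatible cB cB1 g g' ->
  compatible (tensor_component cA cB) (tensor_component cA1 cB1)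
    (tensor_map f g) (tensor_map f' g').
Proof.
move=> ff gg.
have linl : linear (fun t => tensor_proj cA1 cB1 (tensor_map f g t)).
  by move=> a x y; rewrite linearP tensor_proj_linear.
have linr : linear (fun t => tensor_map f' g' (tensor_proj cA cB t) : res _).
  by move=> a x y; rewrite tensor_proj_linear [LHS]linearP.
apply: (tensor_lift_uniq (f := lin_of linl) (g := lin_of linr)) => x y /=.
by rewrite tensor_mapE !tensor_projE tensor_mapE ff gg.
Qed.

(** A test sequence over R_i restricts to a test sequence over S; tensored with F
and cut down to its i-th component, it is the original one tensored with F'. *)
Lemma flat_component i (F : lmodType S) (F' : lmodType (R i)) (c : component F F') :
  flat F -> flat F'.
Proof.
move=> flatF A B C f g fg.
have id_compatible : compatible c c idfun idfun by [].
apply: (exact_component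
  (tensor_compatible (cB := res_component A) (cB1 := res_component B)
     (g := res_map f) id_compatible _)
  (tensor_compatible (cB := res_component B) (cB1 := res_component C)
     (g := res_map g) id_compatible _)) => //.
exact: flatF.
Qed.

(** Conversely, a test sequence over S is replaced by its corners. *)
Lemma flat_components (F : lmodType S) (F' : forall i, lmodType (R i))
    (c : forall i, component F (F' i)) :
  (forall i, flat (F' i)) -> flat F.
Proof.
move=> flatF A B C f g fg.
have id_compatible i : compatible (c i) (c i) idfun idfun by [].
apply: (exact_components
  (fun i => tensor_compatible (id_compatible i) (corner_map_compatible i f))
  (fun i => tensor_compatible (id_compatible i) (corner_map_compatible i g))) => i.
apply: flatF.
exact: exact_component (corner_map_compatible i f) (corner_map_compatible i g) fg.
Qed.

(** An extension problem over R_i is restricted to S, where the map into the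
component is followed by the inclusion; the solution is projected back. *)
Lemma injective_component i (I : lmodType S) (I' : lmodType (R i))
    (c : component I I') : injective_module I -> injective_module I'.
Proof.
move=> injI A B j f j_inj.
have lin : linear (fun x : res A => cincl c (f x)).
  by move=> a x y; rewrite -cinclP -linearP.
have [g gE] := injI (res A) (res B) (res_map j) (lin_of lin) j_inj.
have ling : linear (fun x : B => cproj c (g (x : res B))).
  move=> r x y.
  have -> : r *: x + y = (single r *: (x : res B) + y : res B).
    by rewrite single_res.
  by rewrite linearP cprojP single_in.
by exists (lin_of ling) => x; rewrite /= gE /= cinclK.
Qed.

(** Restriction is right adjoint to taking corners, which preserves injective
maps. *)
Lemma injective_res i (I : lmodType (R i)) :
  injective_module I -> injective_module (res I).
Proof.
move=> injI A B j f j_inj.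
set cA := corner_component i A; set cB := corner_component i B.
have lin : linear (fun x => f (cincl cA x) : I).
  move=> r x y; rewrite cincl_linear linearP.
  by rewrite single_res.
have corner_inj : injective (corner_map i j).
  move=> x y /(congr1 (cincl cB)).
  rewrite -!(compatible_cincl (corner_map_compatible i j)) => /j_inj.
  exact: (can_inj (cinclK cA)).
have [g gE] := injI _ _ _ (lin_of lin) corner_inj.
have ling : linear (fun x => g (cproj cB x) : res I).
  by move=> a x y; rewrite cprojP linearP.
exists (lin_of ling) => x.
have jx : cproj cB (j x) = corner_map i j (cproj cA x).
  exact: corner_map_compatible.
rewrite -[LHS]/(g (cproj cB (j x))) jx gE -[LHS]/(f (cincl cA (cproj cA x))).
by rewrite cprojK linearZ [RHS]res_projK.
Qed.

(** * Totally acyclic complexes *)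

Record seq_component i (C : mod_seq S) (D : mod_seq (R i)) := SeqComponent {
  seq_comp : forall n, component (C n) (D n);
  seq_compP : forall n,
    compatible (seq_comp n) (seq_comp (n - 1)) (diff C n) (diff D n) }.
Arguments seq_compP [i C D] s n x.

(** The conditions shared by the complexes that define Gorenstein flat and
strongly Gorenstein flat modules. *)
Definition totally_acyclic (A : comPzRingType) (C : mod_seq A) : Prop :=
  [/\ forall n, flat (C n), exact_seq C
    & forall I, injective_module I -> exact_seq (tensor_seq C I)].

(** An injective test module over R_i is the component of its restriction, which
is an injective test module over S. *)
Lemma totally_acyclic_component i (C : mod_seq S) (D : mod_seq (R i))
    (c : seq_component C D) : totally_acyclic C -> totally_acyclic D.
Proof.
case=> flatC exC tenC; split=> [n|n|I injI n].
- exact: flat_component (seq_comp c n) (flatC n).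
- exact: exact_component (seq_compP c n) (seq_compP c (n - 1)) (exC n).
have id_compatible : compatible (res_component I) (res_component I) idfun idfun.
  by [].
apply: (exact_component (tensor_compatible (seq_compP c n) id_compatible)
  (tensor_compatible (seq_compP c (n - 1)) id_compatible)).
exact: tenC (injective_res injI) n.
Qed.

(** The components of an injective test module over S are its corners, which are
injective over each R_i. *)
Lemma totally_acyclic_components (C : mod_seq S) (D : forall i, mod_seq (R i))
    (c : forall i, seq_component C (D i)) :
  (forall i, totally_acyclic (D i)) -> totally_acyclic C.
Proof.
move=> acD; split=> [n|n|I injI n].
- by apply: (flat_components (fun i => seq_comp (c i) n)) => i; case: (acD i).
- apply: (exact_components (fun i => seq_compP (c i) n)
    (fun i => seq_compP (c i) (n - 1))) => i.
  by case: (acD i) => _ exD _; exact: exD.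
pose cI i := corner_component i I.
have id_compatible i : compatible (cI i) (cI i) idfun idfun by [].
apply: (exact_components
  (fun i => tensor_compatible (seq_compP (c i) n) (id_compatible i))
  (fun i => tensor_compatible (seq_compP (c i) (n - 1)) (id_compatible i))) => i.
case: (acD i) => _ _ tenD; exact: tenD (injective_component (cI i) injI) n.
Qed.

(** * Images and isomorphisms *)

Section ImageComponent.
Variables (i : 'I_m) (A B : lmodType S) (A' B' : lmodType (R i)).
Variables (cA : component A A') (cB : component B B').
Variables (f : {linear A -> B}) (f' : {linear A' -> B'}).
Hypothesis ff : compatible cA cB f f'.

Fact im_projE (y : im_module f) : cproj cB (val y) \in im_pred f'.
Proof.
by case/asboolP: (valP y) => x <-; apply/asboolP; exists (cproj cA x); rewrite ff.
Qed.
Fact im_inclE (y : im_module f') : cincl cB (val y) \in im_pred f.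
Proof.
case/asboolP: (valP y) => x <-; apply/asboolP; exists (cincl cA x).
exact: compatible_cincl ff x.
Qed.

Definition im_proj (y : im_module f) : im_module f' :=
  exist (fun y => y \in im_pred f') _ (im_projE y).
Definition im_incl (y : im_module f') : im_module f :=
  exist (fun y => y \in im_pred f) _ (im_inclE y).

Fact im_projP (a : S) x y : im_proj (a *: x + y) = a i *: im_proj x + im_proj y.
Proof. by apply: val_inj; rewrite /= cprojP. Qed.
Fact im_inclK : cancel im_incl im_proj.
Proof. by move=> x; apply: val_inj; rewrite /= cinclK. Qed.
Fact im_projK x : im_incl (im_proj x) = single (1 : R i) *: x.
Proof. by apply: val_inj; rewrite /= cprojK. Qed.

Definition im_component : component (im_module f) (im_module f') :=
  Component im_projP im_inclK im_projK.

End ImageComponent.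

Lemma isomorphic_component i (M M1 : lmodType S) (N N1 : lmodType (R i))
    (c : component M N) (c1 : component M1 N1) : isomorphic M M1 -> isomorphic N N1.
Proof.
case=> h [k hK kK].
have lin : linear (fun x => cproj c1 (h (cincl c x))).
  by move=> r x y; rewrite cincl_linear linearP cprojP single_in.
exists (lin_of lin); exists (fun y => cproj c (k (cincl c1 y))) => x /=.
  by rewrite cprojK -linearZ single_cincl hK cinclK.
by rewrite cprojK (linearZ_LR h) kK single_cincl cinclK.
Qed.

Lemma isomorphic_components (M M1 : lmodType S) (N N1 : forall i, lmodType (R i))
    (c : forall i, component M (N i)) (c1 : forall i, component M1 (N1 i)) :
  (forall i, isomorphic (N i) (N1 i)) -> isomorphic M M1.
Proof.
case/fin_all_exists=> h h_bij.
have /fin_all_exists2[k hK kK] i : exists2 k, cancel (h i) k & cancel k (h i).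
  by case: (h_bij i) => k; exists k.
have lin : linear (fun x => \sum_i cincl (c1 i) (h i (cproj (c i) x))).
  move=> a x y; rewrite scaler_sumr -big_split; apply: eq_bigr => i _ /=.
  by rewrite cprojP linearP cinclP.
exists (lin_of lin); exists (fun y => \sum_i cincl (c i) (k i (cproj (c1 i) y))).
  move=> x; apply: (eq_cproj (c := c)) => i /=.
  by rewrite !cproj_sum_cincl hK.
move=> y; apply: (eq_cproj (c := c1)) => i /=.
by rewrite !cproj_sum_cincl kK.
Qed.

(** * Gorenstein flat modules over a product *)

Definition corner_seq i (C : mod_seq S) : mod_seq (R i) :=
  @ModSeq (R i) (fun n => corner i (C n)) (fun n => corner_map i (diff C n)).

Definition corner_seq_component i (C : mod_seq S) : seq_component C (corner_seq i C) :=
  @SeqComponent i C (corner_seq i C) (fun n => corner_component i (C n))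
    (fun n => corner_map_compatible i (diff C n)).

Definition prod_seq (D : forall i, mod_seq (R i)) : mod_seq S :=
  @ModSeq S (fun n => prod_module (fun i => D i n))
    (fun n => prod_map (fun i => diff (D i) n)).

Definition prod_seq_component (D : forall i, mod_seq (R i)) i :
    seq_component (prod_seq D) (D i) :=
  @SeqComponent i (prod_seq D) (D i) (fun n => coord_component (fun i => D i n) i)
    (fun n => prod_map_compatible (fun i => diff (D i) n) i).

Lemma Gorenstein_flat_component i (M : lmodType S) (N : lmodType (R i))
    (c : component M N) : Gorenstein_flat M -> Gorenstein_flat N.
Proof.
case=> C [flatC exC isoM tenC]; exists (corner_seq i C).
have cC := corner_seq_component i C.
have [] : totally_acyclic (corner_seq i C) by apply: totally_acyclic_component cC _.
move=> ? ? ?; split=> //.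
exact: isomorphic_component c (im_component (seq_compP cC 0)) isoM.
Qed.

Lemma Gorenstein_flat_components (M : lmodType S) (N : forall i, lmodType (R i))
    (c : forall i, component M (N i)) :
  (forall i, Gorenstein_flat (N i)) -> Gorenstein_flat M.
Proof.
case/fin_all_exists=> D gfD; exists (prod_seq D).
pose cD := prod_seq_component D.
have [] : totally_acyclic (prod_seq D).
  by apply: (totally_acyclic_components cD) => i; case: (gfD i).
move=> ? ? ?; split=> //.
apply: (isomorphic_components c (fun i => im_component (seq_compP (cD i) 0))) => i.
by case: (gfD i).
Qed.

(** The complex of corners of a constant sequence is again constant, by
conversion; the same holds for products of sequences below. *)
Lemma strongly_Gorenstein_flat_component i (M : lmodType S) (N : lmodType (R i))
    (c : component M N) : strongly_Gorenstein_flat M -> strongly_Gorenstein_flat N.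
Proof.
case=> F [f [flatF exF isoM tenF]]; exists (corner i F), (corner_map i f).
have cC := corner_seq_component i (const_seq f).
have [flatC ? ?] : totally_acyclic (const_seq (corner_map i f)).
  exact: totally_acyclic_component cC _.
split=> //; first exact: (flatC 0).
exact: isomorphic_component c (im_component (corner_map_compatible i f)) isoM.
Qed.

Lemma strongly_Gorenstein_flat_components (M : lmodType S)
    (N : forall i, lmodType (R i)) (c : forall i, component M (N i)) :
  (forall i, strongly_Gorenstein_flat (N i)) -> strongly_Gorenstein_flat M.
Proof.
case/fin_all_exists=> F /fin_all_exists[f sgf].
exists (prod_module F), (prod_map f).
have [flatC ? ?] : totally_acyclic (const_seq (prod_map f)).
  apply: (totally_acyclic_components
    (prod_seq_component (fun i => const_seq (f i)))) => i.
  by case: (sgf i).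
split=> //; first exact: (flatC 0).
apply: (isomorphic_components c
  (fun i => im_component (prod_map_compatible f i))) => i.
by case: (sgf i).
Qed.

End Components.

(** * The zero module and the comparison of the two classes *)

Section ZeroModule.
Variable R : comPzRingType.

Lemma exact_zero (A B C : lmodType R) (f : {linear A -> B}) (g : {linear B -> C}) :
  (forall y : B, y = 0) -> exact f g.
Proof.
move=> B0 y; rewrite (B0 y) linear0; split=> // _.
by exists 0; rewrite linear0.
Qed.

Lemma tensor_zero (M N : lmodType R) :
  (forall x : M, x = 0) -> forall t : tensor M N, t = 0.
Proof.
move=> M0 t; rewrite (tensor_sum t) big1 // => p _.
by rewrite (M0 p.1) -(scale0r 0) tmulZl scale0r.
Qed.

Lemma strongly_Gorenstein_flat_zero (M : lmodType R) :
  (forall x : M, x = 0) -> strongly_Gorenstein_flat M.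
Proof.
move=> M0; exists M, idfun; split.
- by move=> A B C f g _; apply: exact_zero; exact: tensor_zero.
- by move=> n; exact: exact_zero.
- have lin : linear (fun _ : M => 0 : im_module (idfun : {linear M -> M})).
    by move=> a x y; rewrite scaler0 addr0.
  exists (lin_of lin); exists (fun=> 0) => [x|y] /=; first by rewrite [RHS]M0.
  by apply: val_inj; rewrite [RHS]M0 [LHS]M0.
- by move=> I _ n; apply: exact_zero; exact: tensor_zero.
Qed.

Lemma strongly_Gorenstein_flat_is_Gorenstein_flat (M : lmodType R) :
  strongly_Gorenstein_flat M -> Gorenstein_flat M.
Proof. by case=> F [f [? ? ? ?]]; exists (const_seq f). Qed.

End ZeroModule.

Theorem theorem2p9 (m : nat) (hm : (0 < m)%N) (R : 'I_m -> comPzRingType)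
    (hcoh : forall i, coherent (R i)) (hdim : forall i, Gwdim (R i) <> None) :
  SGF_eq_GF (prod_ring R) <-> forall i, SGF_eq_GF (R i).
Proof.
split=> [sgf i M|sgf M]; split=> [/strongly_Gorenstein_flat_is_Gorenstein_flat //|gf].
  (* The product of M, as i-th factor, with zero modules as the other factors. *)
  pose zero j : lmodType (R j) := 'rV[R j]_0.
  pose N j : lmodType (R j) := dfwith zero M j.
  have gfN j : Gorenstein_flat (N j).
    rewrite /N; case: dfwithP => // k _.
    apply/strongly_Gorenstein_flat_is_Gorenstein_flat/strongly_Gorenstein_flat_zero.
    by move=> x; exact: thinmx0.
  rewrite -[M](dfwith_in zero).
  apply: (strongly_Gorenstein_flat_component (coord_component N i)).
  by apply/sgf/(Gorenstein_flat_components (coord_component N)).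
apply: (strongly_Gorenstein_flat_components
  (fun i => corner_component i M)) => i.
by apply/sgf/(Gorenstein_flat_component (corner_component i M)).
Qed.
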